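(* Let $$B=\begin{bmatrix} B_1 & \dot B_1 & O & \cdots & O\\ B_2 & O & \dot B_2 & \cdots & O\\ \vdots & \vdots & \vdots & \ddots & \vdots\\ B_m & O & O & \cdots & \dot B_m\end{bmatrix},\qquad b=\begin{bmatrix} b_1\\ b_2\\ \vdots\\ b_m\end{bmatrix},$$ where, for $1\le i\le m$, $B_i$ is $n_i\times p$, $\dot B_i$ is $n_i\times q$ and $b_i$ is $n_i\times 1$. Suppose that $B$ has full (column) rank, and let $A=B^TB$ and $a=B^Tb$. Carry out the following steps. 1. For $i=1,\ldots,m$: decompose $\dot B_i=Q_i\begin{bmatrix}R_i\\ O\end{bmatrix}$ such that $Q_i^{-1}=Q_i^T$ and $R_i$ is a $q\times q$ upper-triangular matrix. Let $c_{0i}=Q_i^Tb_i$, let $c_{1i}$ be the first $q$ rows of $c_{0i}$ and $c_{2i}$ the remaining rows of $c_{0i}$; let $C_{0i}=Q_i^TB_i$, let $C_{1i}$ be the first $q$ rows of $C_{0i}$ and $C_{2i}$ the remaining rows of $C_{0i}$. 2. Decompose $\mathrm{stack}_{1\le i\le m}(C_{2i})=Q\begin{bmatrix}R\\ O\end{bmatrix}$ such that $Q^{-1}=Q^T$ and $R$ is a $p\times p$ upper-triangular matrix, and let $c$ be the first $p$ rows of $Q^T\{\mathrm{stack}_{1\le i\le m}(c_{2i})\}$. Then the solution $x$ of $Ax=a$, and the sub-blocks $A^{11}$, $A^{12,i}$, $A^{22,i}$ of $A^{-1}$, are given by $$x_1=R^{-1}c,\qquad A^{11}=R^{-1}R^{-T}$$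 and, for $1\le i\le m$, $$x_{2,i}=R_i^{-1}(c_{1i}-C_{1i}x_1),\qquad A^{12,i}=-A^{11}\left(R_i^{-1}C_{1i}\right)^T,\qquad A^{22,i}=R_i^{-1}\left(R_i^{-T}-C_{1i}A^{12,i}\right).$$ Moreover, the determinant of $A$ is $$|A|=\left\{(\text{product of the diagonal entries of }R)\prod_{i=1}^m(\text{product of the diagonal entries of }R_i)\right\}^2.$$
   Context: All matrices and vectors are real; $m,p,q$ and the $n_i$ are positive integers. $O$ denotes a zero matrix (possibly with no rows) of appropriate size; $M^{-T}=(M^{-1})^T$; $|M|$ is the determinant of a square matrix $M$. For matrices $M_1,\ldots,M_d$ with the same number of columns, $\mathrm{stack}_{1\le i\le d}(M_i)$ is the matrix obtained by placing $M_1,\ldots,M_d$ vertically on top of each other in that order. $\dot B_i$ is just a name for a matrix (the dot is not a derivative). The matrix $A=B^TB$ is symmetric with the two-level sparse form $$A=\begin{bmatrix} A_{11} & A_{12,1} & \cdots & A_{12,m}\\ A_{12,1}^T & A_{22,1} & \cdots & O\\ \vdots & \vdots & \ddots & \vdots\\ A_{12,m}^T & O & \cdots & A_{22,m}\end{bmatrix},$$ where $A_{11}=\sum_{i=1}^m B_i^TB_i$ is $p\times p$, $A_{12,i}=B_i^T\dot B_i$ is $p\times q$, $A_{22,i}=\dot B_i^T\dot B_i$ is $q\times q$. The inverse $A^{-1}$ is partitioned in the same way: $A^{11}$, $A^{12,i}$, $A^{22,i}$ denote the blocks of $A^{-1}$ in the positions of $A_{11}$, $A_{12,i}$, $A_{22,i}$,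 respectively (superscripts are block labels, not powers). The solution $x$ of $Ax=a$ is partitioned conformably as the stack of $x_1$ ($p\times 1$), $x_{2,1},\ldots,x_{2,m}$ (each $q\times1$). A QR decomposition of an $n\times k$ matrix $X$ ($n\ge k$) is $X=Q\begin{bmatrix}R\\ O\end{bmatrix}$ with $Q$ an $n\times n$ orthogonal matrix and $R$ a $k\times k$ upper-triangular matrix. *)

(* Defs.v *)
From HB Require Import structures.
From mathcomp Require Import all_boot all_order all_algebra.
From mathcomp Require Import reals.

Set Implicit Arguments.
Unset Strict Implicit.
Unset Printing Implicit Defensive.

Import Order.TTheory GRing.Theory Num.Theory.
Local Open Scope ring_scope.

(* [n] and [k + (n - k)] are equal but not convertible when [k <= n], hence the
   use of [conform_mx]; the three functions below are only meant for [k <= n]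
   (see the lemmas that follow them). *)
Definition top_rows (R : realType) (n l k : nat) (M : 'M[R]_(n, l)) :
    'M[R]_(k, l) :=
  usubmx (conform_mx (0 : 'M[R]_(k + (n - k), l)) M).

Definition bottom_rows (R : realType) (n l k : nat) (M : 'M[R]_(n, l)) :
    'M[R]_(n - k, l) :=
  dsubmx (conform_mx (0 : 'M[R]_(k + (n - k), l)) M).

Definition pad_rows (R : realType) (n k : nat) (T : 'M[R]_k) : 'M[R]_(n, k) :=
  conform_mx (0 : 'M[R]_(n, k)) (col_mx T (0 : 'M[R]_(n - k, k))).

Lemma top_rowsE (R : realType) (n l k : nat) (M : 'M[R]_(n, l))
    (kn : (k <= n)%N) :
  top_rows k M = rowsub (widen_ord kn) M.
Proof.
rewrite /top_rows -(conform_castmx (esym (subnKC kn), erefl l) 0 M) conform_mx_id.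
by apply/matrixP=> i j; rewrite !mxE castmxE; congr (M _ _); apply: val_inj.
Qed.

Lemma bottom_rowsE (R : realType) (n l k : nat) (M : 'M[R]_(n, l))
    (kn : (k <= n)%N) :
  bottom_rows k M = rowsub (fun i => cast_ord (subnKC kn) (rshift k i)) M.
Proof.
rewrite /bottom_rows -(conform_castmx (esym (subnKC kn), erefl l) 0 M).
rewrite conform_mx_id.
by apply/matrixP=> i j; rewrite !mxE castmxE; congr (M _ _); apply: val_inj.
Qed.

Lemma pad_rowsE (R : realType) (n k : nat) (T : 'M[R]_k) (kn : (k <= n)%N) :
  pad_rows n T = castmx (subnKC kn, erefl k) (col_mx T 0).
Proof.
by rewrite /pad_rows -(conform_castmx (subnKC kn, erefl k)) conform_mx_id.
Qed.

(* [is_trig_mx] means lower triangular, so it is applied to the transpose. *)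
Definition is_QR (R : realType) (n k : nat) (X : 'M[R]_(n, k))
    (Q : 'M[R]_n) (T : 'M[R]_k) : Prop :=
  [/\ (k <= n)%N, Q \in unitmx, invmx Q = Q^T, is_trig_mx T^T
    & X = Q *m pad_rows n T].

(* The diagonal blocks [Bdot i] are not square in general, so [\mxdiag] does not
   apply. *)
Definition two_level_mx (R : realType) (m p q : nat) (n : 'I_m -> nat)
    (B : forall i, 'M[R]_(n i, p)) (Bdot : forall i, 'M[R]_(n i, q)) :
    'M[R]_(\sum_(i < m) n i, p + \sum_(i < m) q) :=
  row_mx (\mxcol_(i < m) B i)
         (\mxblock_(i < m, j < m) (if i == j then Bdot i else 0)).

(* Main.v *)
Require Import Defs.
From HB Require Import structures.
From mathcomp Require Import all_boot all_order all_algebra.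
From mathcomp Require Import reals.

Set Implicit Arguments.
Unset Strict Implicit.
Unset Printing Implicit Defensive.

Import Order.TTheory GRing.Theory Num.Theory.
Local Open Scope ring_scope.

(** The two kinds of QR steps assemble into a single orthonormal factorization
    of the whole matrix [B].  Split each orthogonal factor by columns,
    [Qi = [U_i V_i]] with [U_i] its first [q] columns, and let [G] be the first
    [p] columns of [Q], with block rows [G_i].  The first kind of step gives
    [Bdot_i = U_i R_i] and [B_i = U_i C1_i + V_i C2_i], the second one
    [C2_i = G_i T], so

      [B_i = (V_i G_i) T + U_i C1_i]  and  [Bdot_i = U_i R_i].

    This says [B = W M], where [W] is the two-level matrix with blocks [V_i G_i]
    and [U_i], and [M] is the block lower triangular matrix with diagonal blocks
    [T] and [D = diag(R_i)] and lower left block [C = stack(C1_i)].  The columns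
    of [W] are orthonormal: [U_i] and [V_i] have orthonormal columns and are
    orthogonal to each other, and the [V_i G_i] contribute
    [sum_i G_i^T V_i^T V_i G_i = G^T G = 1].

    Everything follows from [B = W M] and [W^T W = 1].  The rank of [B] bounds
    that of [M] from below, so [M] is invertible.  Then [A = M^T M], whence
    [det A = (det T * det D)^2]; the normal equations reduce to [M x = W^T b],
    where [W^T b] is the stack of [c] and the [c1_i], which forward substitution
    solves; and [A^-1 = M^-1 M^-T] is computed by blocks.  The lemmas carrying
    this are [is_QR_thin], [two_level_mx_mul], [two_level_mx_orthonormal],
    [normal_eq_solve] and [invmx_gram_lblock]. *)

(** * Thin QR decompositions *)

Lemma top_rows_mul (R : realType) (n l r k : nat) (P : 'M[R]_(n, l))
    (M : 'M[R]_(l, r)) (kn : (k <= n)%N) :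
  top_rows k (P *m M) = top_rows k P *m M.
Proof. by rewrite !top_rowsE mul_rowsub_mx. Qed.

Lemma bottom_rows_mul (R : realType) (n l r k : nat) (P : 'M[R]_(n, l))
    (M : 'M[R]_(l, r)) (kn : (k <= n)%N) :
  bottom_rows k (P *m M) = bottom_rows k P *m M.
Proof. by rewrite !bottom_rowsE mul_rowsub_mx. Qed.

(** Cutting the square orthogonal factor into its first [k] columns [U] and the
    others [V] turns the padded factorization into one without zero rows.  They
    are written as transposes of row blocks of [Q^T] so that the row blocks of
    [Q^T *m Y] are [U^T *m Y] and [V^T *m Y]. *)
Lemma is_QR_thin (R : realType) (n k : nat) (X : 'M[R]_(n, k)) (Q : 'M[R]_n)
    (T : 'M[R]_k) :
  is_QR X Q T ->
  let U := (top_rows k Q^T)^T in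
  let V := (bottom_rows k Q^T)^T in
  [/\ U^T *m U = 1%:M, V^T *m V = 1%:M, U^T *m V = 0,
      U *m U^T + V *m V^T = 1%:M & X = U *m T].
Proof.
case=> kn uQ iQ _ -> /=; rewrite !trmxK.
have QQT : Q *m Q^T = 1%:M by rewrite -iQ mulmxV.
have QTQ : Q^T *m Q = 1%:M by rewrite -iQ mulVmx.
rewrite pad_rowsE /top_rows /bottom_rows.
rewrite -(conform_castmx (esym (subnKC kn), erefl n) 0 Q^T) conform_mx_id.
(* [n] and [k + (n - k)] are not convertible: abstracting [n - k] makes the
   equation between them eliminable, which removes every cast. *)
move: (subnKC kn); move: (n - k)%N => d e; clear kn iQ.
case: _ / e Q uQ QQT QTQ => Q _ QQT QTQ; rewrite !castmx_id.
have EQ : Q = row_mx (usubmx Q^T)^T (dsubmx Q^T)^T.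
  by rewrite -tr_col_mx vsubmxK trmxK.
move: (usubmx Q^T) (dsubmx Q^T) EQ QQT QTQ => U V ->.
rewrite tr_row_mx !trmxK mul_row_col mul_col_row scalar_mx_block mul_row_col.
by move=> -> /eq_block_mx[-> -> _ ->]; rewrite mulmx0 addr0.
Qed.

Lemma det_is_QR (R : realType) (n k : nat) (X : 'M[R]_(n, k)) (Q : 'M[R]_n)
    (T : 'M[R]_k) :
  is_QR X Q T -> \det T = \prod_(i < k) T i i.
Proof.
case=> _ _ _ trT _; rewrite -det_tr det_trig//.
by apply: eq_bigr => i _; rewrite mxE.
Qed.

(** * Block diagonal matrices *)

Lemma mul_mxdiag (R : pzSemiRingType) (m : nat) (p_ : 'I_m -> nat)
    (S U : forall i, 'M[R]_(p_ i)) :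
  (\mxdiag_(i < m) S i) *m (\mxdiag_(i < m) U i) = \mxdiag_(i < m) (S i *m U i).
Proof.
rewrite [X in _ *m X]/mxdiag mul_mxdiag_mxblock; apply: eq_mxblock => i j.
by case: eqP => [->|_]; rewrite ?mulmx0 ?conform_mx_id.
Qed.

Lemma det_mxdiag_trig (R : comNzRingType) (m : nat) (p_ : 'I_m -> nat)
    (S : forall i, 'M[R]_(p_ i)) :
  (forall i, is_trig_mx (S i)) ->
  \det (\mxdiag_(i < m) S i) = \prod_(i < m) \prod_(k < p_ i) S i k k.
Proof.
move=> trS; rewrite det_trig; last first.
  apply/is_trig_mxblockP; split=> [i j|i]; last by rewrite eqxx conform_mx_id.
  by case: eqP => // ->; rewrite ltnn.
rewrite sig_big_dep (reindex _ (@tagnat.sig_bij_on _ _))/=.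
by apply: eq_bigr => k _; rewrite !mxE eqxx conform_mx_id.
Qed.

(** Here the diagonal blocks are rectangular, which [\mxdiag] excludes. *)
Lemma tr_block_diag_mul_mxcol (R : pzSemiRingType) (m q l : nat)
    (n : 'I_m -> nat) (Y : forall i, 'M[R]_(n i, q))
    (C : forall i, 'M[R]_(n i, l)) :
  (\mxblock_(i < m, j < m) (if i == j then Y i else 0))^T
    *m (\mxcol_(i < m) C i) = \mxcol_(i < m) ((Y i)^T *m C i).
Proof.
rewrite tr_mxblock mul_mxblock_mxrow; apply: eq_mxcol => i.
by rewrite (bigD1 i)//= eqxx big1 ?addr0// => j /negPf ji;
  rewrite ji trmx0 mul0mx.
Qed.

(** * Two-level matrices *)

(** Two-level matrices are stable under right multiplication by a block lower
    triangular matrix whose second diagonal block is itself block diagonal: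
    the [i]-th block row only involves the blocks of index [i].  Read from right
    to left, it factors a two-level matrix blockwise. *)
Lemma two_level_mx_mul (R : realType) (m p q : nat) (n : 'I_m -> nat)
    (X : forall i, 'M[R]_(n i, p)) (Y : forall i, 'M[R]_(n i, q))
    (T : 'M[R]_p) (C : 'I_m -> 'M[R]_(q, p)) (S : 'I_m -> 'M[R]_q) :
  two_level_mx X Y *m
    block_mx T 0 (\mxcol_(i < m) C i) (\mxdiag_(i < m) S i) =
  two_level_mx (fun i => X i *m T + Y i *m C i) (fun i => Y i *m S i).
Proof.
rewrite /two_level_mx mul_row_block mulmx0 add0r mxcol_mul mxcolD.
rewrite mul_mxblock_mxdiag mul_mxblock_mxrow; congr (row_mx (_ + _) _).
  apply: eq_mxcol => i; rewrite (bigD1 i)//= eqxx big1 ?addr0// => j /negPf ji.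
  by rewrite eq_sym ji mul0mx.
by apply: eq_mxblock => i j; case: eqP => [->|]; rewrite ?mul0mx.
Qed.

Lemma tr_two_level_mx_mul_mxcol (R : realType) (m p q l : nat)
    (n : 'I_m -> nat) (X : forall i, 'M[R]_(n i, p))
    (Y : forall i, 'M[R]_(n i, q)) (b : forall i, 'M[R]_(n i, l)) :
  (two_level_mx X Y)^T *m (\mxcol_(i < m) b i) =
  col_mx (\sum_i (X i)^T *m b i) (\mxcol_(i < m) ((Y i)^T *m b i)).
Proof.
rewrite /two_level_mx tr_row_mx mul_col_mx tr_mxcol mul_mxrow_mxcol.
by rewrite tr_block_diag_mul_mxcol.
Qed.

(** Distinct [Y i] occupy disjoint block rows, so their orthogonality is
    automatic, and that of [X] and [Y] can be tested blockwise; only the first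
    block column requires a sum over [i]. *)
Lemma two_level_mx_orthonormal (R : realType) (m p q : nat)
    (n : 'I_m -> nat) (X : forall i, 'M[R]_(n i, p))
    (Y : forall i, 'M[R]_(n i, q)) :
  \sum_i (X i)^T *m X i = 1%:M -> (forall i, (Y i)^T *m X i = 0) ->
  (forall i, (Y i)^T *m Y i = 1%:M) ->
  (two_level_mx X Y)^T *m two_level_mx X Y = 1%:M.
Proof.
move=> XX YX YY; have YXs : (\mxblock_(i < m, j < m)
    (if i == j then Y i else 0))^T *m (\mxcol_(i < m) X i) = 0.
  by rewrite tr_block_diag_mul_mxcol; under eq_mxcol do rewrite YX; exact: mxcol0.
rewrite /two_level_mx tr_row_mx mul_col_row YXs scalar_mx_block; congr block_mx.
- by rewrite tr_mxcol mul_mxrow_mxcol.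
- by apply: trmx_inj; rewrite trmx_mul trmxK YXs trmx0.
rewrite [X in _ *m X]mxblockEh mul_mxrow -mxdiagZ [RHS]mxblockEh; apply: eq_mxrow => j.
rewrite tr_block_diag_mul_mxcol; apply: eq_mxcol => i; rewrite conform_mx_id.
by case: eqP => _; rewrite ?mulmx0.
Qed.

(** * Consequences of an orthonormal factorization *)

(** With [B = W M], the normal equations read [M^T (M x) = M^T (W^T b)], and
    [M^T] can be cancelled. *)
Lemma normal_eq_solve (R : comUnitRingType) (N n l : nat)
    (B W : 'M[R]_(N, n)) (M : 'M[R]_n) (b : 'M[R]_(N, l)) (x : 'M[R]_(n, l)) :
  B = W *m M -> W^T *m W = 1%:M -> M \in unitmx ->
  B^T *m B *m x = B^T *m b -> M *m x = W^T *m b.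
Proof.
move=> -> WW uM; rewrite trmx_mul -!mulmxA (mulmxA W^T) WW mul1mx.
by apply: (can_inj (mulKmx _)); rewrite unitmx_tr.
Qed.

(** The right-hand side is [M^-1 M^-T]; the lower right block is written in terms
    of the upper right one.  Multiplying it by [M] leaves [M^-T], which is block
    upper triangular, and multiplying that by [M^T] gives the identity. *)
Lemma invmx_gram_lblock (R : comUnitRingType) (p k : nat) (T : 'M[R]_p)
    (C : 'M[R]_(k, p)) (D : 'M[R]_k) :
  T \in unitmx -> D \in unitmx ->
  let M := block_mx T 0 C D in
  let A11 := invmx T *m (invmx T)^T in
  let A12 := - (A11 *m (invmx D *m C)^T) in
  invmx (M^T *m M) =
    block_mx A11 A12 A12^T (invmx D *m ((invmx D)^T - C *m A12)).
Proof.
move=> uT uD M A11 A12; set N := block_mx A11 _ _ _.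
have A11T : A11^T = A11 by rewrite trmx_mul trmxK.
have TA11 : T *m A11 = (invmx T)^T by rewrite mulmxA mulmxV ?mul1mx.
have A12E : A12 = - (A11 *m C^T *m (invmx D)^T) by rewrite /A12 trmx_mul mulmxA.
have TA12 : T^T *m (T *m A12) + C^T *m (invmx D)^T = 0.
  rewrite A12E mulmxN -(mulmxA A11) (mulmxA T) TA11 mulmxN mulmxA.
  by rewrite -trmx_mul mulVmx// trmx1 mul1mx addNr.
have MN : M *m N = block_mx (T *m A11) (T *m A12) 0 (invmx D)^T.
  rewrite mulmx_block !mul0mx !addr0; congr block_mx.
    rewrite /A12 linearN/= trmx_mul trmxK A11T mulmxN !mulmxA mulmxV// mul1mx.
    exact: subrr.
  by rewrite mulmxA mulmxV// mul1mx addrC subrK.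
have MMN : M^T *m M *m N = 1%:M.
  rewrite -mulmxA MN tr_block_mx mulmx_block trmx0 !mul0mx !mulmx0 !addr0 TA12.
  by rewrite TA11 -!trmx_mul !mulVmx// !trmx1 add0r -scalar_mx_block.
have [uMM _] := mulmx1_unit MMN.
by rewrite -[RHS](mulKmx uMM) MMN mulmx1.
Qed.

(** * The two-level least squares formulas *)

Theorem theorem2 (R : realType) (m p q : nat) (n : 'I_m -> nat)
    (m_gt0 : (0 < m)%N) (p_gt0 : (0 < p)%N) (q_gt0 : (0 < q)%N)
    (n_gt0 : forall i, (0 < n i)%N)
    (Bi : forall i, 'M[R]_(n i, p)) (Bdot : forall i, 'M[R]_(n i, q))
    (bi : forall i, 'cV[R]_(n i)) :
  let B := two_level_mx Bi Bdot in
  let b := \mxcol_(i < m) bi i in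
  let A := B^T *m B in
  let a := B^T *m b in
  \rank B = (p + \sum_(i < m) q)%N ->
  forall (Qi : forall i, 'M[R]_(n i)) (Ri : 'I_m -> 'M[R]_q),
  (forall i, is_QR (Bdot i) (Qi i) (Ri i)) ->
  let c0 i := (Qi i)^T *m bi i in
  let c1 i := top_rows q (c0 i) in
  let c2 i := bottom_rows q (c0 i) in
  let C0 i := (Qi i)^T *m Bi i in
  let C1 i := top_rows q (C0 i) in
  let C2 i := bottom_rows q (C0 i) in
  forall (Q : 'M[R]_(\sum_(i < m) (n i - q))) (T : 'M[R]_p),
  is_QR (\mxcol_(i < m) C2 i) Q T ->
  let c := top_rows p (Q^T *m \mxcol_(i < m) c2 i) in
  let A11 := ulsubmx (invmx A) in
  let A12 i := submxrow (ursubmx (invmx A)) i in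
  let A22 i := submxblock (drsubmx (invmx A)) i i in
  [/\ [/\ A \in unitmx, T \in unitmx & forall i, Ri i \in unitmx],
      forall x : 'cV[R]_(p + \sum_(i < m) q), A *m x = a ->
        let x1 := usubmx x in
        let x2 i := submxcol (dsubmx x) i in
        x1 = invmx T *m c /\
        forall i, x2 i = invmx (Ri i) *m (c1 i - C1 i *m x1),
      A11 = invmx T *m (invmx T)^T,
      forall i,
        A12 i = - (A11 *m (invmx (Ri i) *m C1 i)^T) /\
        A22 i = invmx (Ri i) *m ((invmx (Ri i))^T - C1 i *m A12 i)
    & \det A =
        ((\prod_(k < p) T k k) * \prod_(i < m) \prod_(k < q) Ri i k k) ^+ 2].
Proof.
move=> B b A a rkB Qi Ri QRi c0 c1 c2 C0 C1 C2 Q T QRT c A11 A12 A22.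
have qn i : (q <= n i)%N by case: (QRi i).
have ps : (p <= \sum_(i < m) (n i - q))%N by case: QRT.
pose U i := (top_rows q (Qi i)^T)^T; pose V i := (bottom_rows q (Qi i)^T)^T.
pose G := (top_rows p Q^T)^T.
pose X i := V i *m submxcol G i.
pose W := two_level_mx X U.
pose D := \mxdiag_(i < m) Ri i.
pose C := \mxcol_(i < m) C1 i.
pose M := block_mx T 0 C D.
have C1E i : C1 i = (U i)^T *m Bi i by rewrite /C1 top_rows_mul// trmxK.
have C2E i : C2 i = (V i)^T *m Bi i by rewrite /C2 bottom_rows_mul// trmxK.
have c1E i : c1 i = (U i)^T *m bi i by rewrite /c1 top_rows_mul// trmxK.
have c2E i : c2 i = (V i)^T *m bi i by rewrite /c2 bottom_rows_mul// trmxK.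
have cE : c = G^T *m \mxcol_(i < m) c2 i by rewrite /c top_rows_mul// trmxK.
have [GG _ _ _ C2G] := is_QR_thin QRT.
have trG : G^T = \mxrow_(i < m) (submxcol G i)^T by rewrite -tr_mxcol submxcolK.
(* [U i *m (U i)^T + V i *m (V i)^T = 1] splits [Bi i] along the columns of
   [U i] and [V i]. *)
have BWM : B = W *m M.
  rewrite two_level_mx_mul; congr (row_mx _ _).
    apply: eq_mxcol => i; have [_ _ _ UV _] := is_QR_thin (QRi i).
    rewrite -mulmxA submxcol_mul -C2G mxcolK C2E C1E !mulmxA -mulmxDl addrC UV.
    by rewrite mul1mx.
  apply: eq_mxblock => i j; case: eqP => // _.
  by have [_ _ _ _ {1}->] := is_QR_thin (QRi i).
have WW : W^T *m W = 1%:M.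
  apply: two_level_mx_orthonormal => [|i|i].
  - rewrite -GG -/G trG -[X in _ *m X](submxcolK G).
    rewrite mul_mxrow_mxcol; apply: eq_bigr => i _.
    have [_ VV _ _ _] := is_QR_thin (QRi i).
    by rewrite trmx_mul -mulmxA (mulmxA (V i)^T) VV mul1mx.
  - have [_ _ UV _ _] := is_QR_thin (QRi i).
    by rewrite mulmxA UV mul0mx.
  - by have [] := is_QR_thin (QRi i).
have Wb : W^T *m b = col_mx c (\mxcol_(i < m) c1 i).
  rewrite tr_two_level_mx_mul_mxcol cE trG mul_mxrow_mxcol; congr col_mx.
    by apply: eq_bigr => i _; rewrite trmx_mul -mulmxA c2E.
  by apply: eq_mxcol => i; rewrite c1E.
have AMM : A = M^T *m M.
  by rewrite /A BWM trmx_mul -mulmxA (mulmxA W^T) WW mul1mx.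
(* [M] is square of size [\rank B], and [\rank (W *m M) <= \rank M]. *)
have uM : M \in unitmx.
  by rewrite -row_full_unit -col_leq_rank -[X in (X <= _)%N]rkB BWM mxrankM_maxr.
have detD : \det D = \prod_(i < m) \det (Ri i).
  rewrite -det_tr tr_mxdiag det_mxdiag_trig => [|i]; last by have [] := QRi i.
  by apply: eq_bigr => i _; rewrite (det_is_QR (QRi i));
    apply: eq_bigr => k _; rewrite mxE.
have detM : \det M = \det T * \det D by rewrite det_lblock.
(* Over a field, a factor of a nonzero determinant is nonzero. *)
have [uT uD] : T \in unitmx /\ D \in unitmx.
  by apply/andP; rewrite !unitmxE -unitrM -detM -unitmxE.
have uR i : Ri i \in unitmx.
  move: uD; rewrite !unitmxE !unitfE detD => /prodf_neq0 nz; exact: nz.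
have uA : A \in unitmx by rewrite AMM unitmx_mul unitmx_tr uM.
have invD : invmx D = \mxdiag_(i < m) invmx (Ri i).
  rewrite -[LHS]mulmx1 -[RHS](mulKmx uD); congr (_ *m _).
  rewrite mul_mxdiag -mxdiagZ; apply: eq_mxdiag => i.
  by rewrite mulmxV.
have iA := invmx_gram_lblock C uT uD; rewrite /= -/M -AMM in iA.
have A11E : A11 = invmx T *m (invmx T)^T by rewrite /A11 iA block_mxKul.
have A12E : ursubmx (invmx A) = - (A11 *m (invmx D *m C)^T).
  by rewrite A11E iA block_mxKur.
have invDl l (Z : 'M[R]_(_, l)) i :
    submxcol (invmx D *m Z) i = invmx (Ri i) *m submxcol Z i.
  by rewrite -{1}[Z]submxcolK invD mul_mxdiag_mxcol mxcolK.
split=> //.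
- move=> x /(normal_eq_solve BWM WW uM).
  rewrite Wb -{1}[x]vsubmxK mul_block_col mul0mx addr0 => /eq_col_mx[Tx CDx].
  split=> [|i]; first by rewrite -Tx mulKmx.
  (* The second block row of [M x = W^T b], solved for [D *m dsubmx x]. *)
  rewrite -[dsubmx x](mulKmx uD) -(addKr (C *m usubmx x) (D *m _)) CDx.
  rewrite invDl addrC submxcolB mxcolK.
  by rewrite -submxcol_mul mxcolK.
- move=> i; split.
    rewrite /A12 A12E submxrowN -mul_submxrow.
    by rewrite -tr_submxcol invDl mxcolK.
  rewrite /A22 iA block_mxKdr submxblockEv invDl -mul_submxrow submxcolB submxrowB.
  rewrite -submxblockEv -tr_submxblock invD submxblock_diag.
  rewrite -submxcol_mul mxcolK -mul_submxrow.
  by rewrite -invD -A11E -A12E.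
- rewrite AMM det_mulmx det_tr detM (det_is_QR QRT) detD -expr2.
  by congr ((_ * _) ^+ 2); apply: eq_bigr => i _; rewrite (det_is_QR (QRi i)).
Qed.
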